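(* Let $(Q,L_d)$ be a discrete mechanical system with symmetry group $G$ and let $\mathcal A_d$ be a discrete connection on the principal $G$-bundle $\pi^{Q,G}:Q\to Q/G$. Let $\mathcal M=(\tilde G,\check L_d,\mathcal P)$ be the associated discrete Lagrange--Poincaré system over $p^{Q/G}:\tilde G\to Q/G$. Let $q_\cdot=(q_0,\ldots,q_N)$, $N\ge2$, be a discrete path in $Q$ and let $(v_\cdot,r_\cdot)$ be the discrete path in $C'(\tilde G)$ given by $(v_k,r_{k+1})=\Upsilon_{\mathcal A_d}(q_k,q_{k+1})$, $k=0,\ldots,N-1$. Then $(v_\cdot,r_\cdot)$ is a trajectory of $\mathcal M$ if and only if it is a trajectory of the reduced system of $(Q,L_d)$, i.e. if and only if $d\check S_d(v_\cdot,r_\cdot)(\delta v_\cdot,\delta r_\cdot)=0$ for all variations of the form $(\delta v_k,\delta r_{k+1})=d\Upsilon_{\mathcal A_d}(q_k,q_{k+1})(\delta q_k,\delta q_{k+1})$, $k=0,\dots,N-1$, where $\delta q_k\in T_{q_k}Q$ and $\delta q_0=0$, $\delta q_N=0$; here $\check S_d(v_\cdot,r_\cdot)=\sum_{k=0}^{N-1}\check L_d(v_k,r_{k+1})$.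
   Context: $p_j$ is the projection on the $j$-th factor; $D_j$ the restriction of the differential to the $j$-th factor of a product; $\pi^{X,G}:X\to X/G$ the quotient map of a left action $l^X$. A principal $G$-bundle is a surjective submersion whose total space carries a smooth free left $G$-action with orbits equal to the fibers. A discrete mechanical system is $(Q,L_d)$ with $Q$ a finite-dimensional manifold and $L_d:Q\times Q\to\mathbb R$ smooth. $G$ is a symmetry group of it if the Lie group $G$ acts on the left on $Q$ by $l^Q$ so that $\pi^{Q,G}:Q\to Q/G$ is a principal $G$-bundle and $L_d(l^Q_g(q_0),l^Q_g(q_1))=L_d(q_0,q_1)$ for all $g$. A discrete connection $\mathcal A_d$ on $\pi^{Q,G}$ is given by a submanifold $Hor\subset Q\times Q$, invariant under the diagonal action and containing the diagonal, such that $(id_Q\times\pi^{Q,G})|_{Hor}:Hor\to Q\times(Q/G)$ is an injective local diffeomorphism. Convention: it is treated as globally defined (this map is onto), so for all $q_0,q_1$ there is a unique $g=:\mathcal A_d(q_0,q_1)$ with $(q_0,l^Q_{g^{-1}}(q_1))\in Hor$; $\mathcal A_d:Q\times Q\to G$ is smooth. $\tilde G=(Q\times G)/G$ with $g\cdot(q,w)=(l^Q_g(q),gwg^{-1})$, a fiber bundle over $Q/G$ via $p^{Q/G}(\pi^{Q\times G,G}(q,w))=\pi^{Q,G}(q)$. $\Upsilon_{\mathcal A_d}:Q\times Q\to\tilde G\times(Q/G)$, $\Upsilon_{\mathcal A_d}(q_0,q_1)=(\pi^{Q\times G,G}(q_0,\mathcal A_d(q_0,q_1)),\pi^{Q,G}(q_1))$.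 $\check L_d:\tilde G\times(Q/G)\to\mathbb R$ is defined by $\check L_d\circ\Upsilon_{\mathcal A_d}=L_d$. For a fiber bundle $\phi:E\to M$: $C'(E)=E\times M$, $C''(E)=\{((\epsilon_0,m_1),(\epsilon_1,m_2)):m_1=\phi(\epsilon_1)\}$. A discrete Lagrange--Poincaré system $(E,L,\mathcal P)$ consists of a smooth $L:C'(E)\to\mathbb R$ and a smooth family of linear maps $\mathcal P((\epsilon_0,m_1),(\epsilon_1,m_2)):T_{\epsilon_1}E\to\ker d\phi(\epsilon_0)$ indexed by $C''(E)$. A discrete path is $((\epsilon_0,m_1),\ldots,(\epsilon_{N-1},m_N))$ with consecutive pairs in $C''(E)$. An infinitesimal variation with fixed endpoints on it is a family $(\delta\epsilon_k,\delta m_{k+1})$, $0\le k\le N-1$, of tangent vectors with $\delta m_k=d\phi(\epsilon_k)(\delta\epsilon_k)$ for $1\le k\le N-1$, $\delta m_N=0$, and such that for some vectors $\widetilde{\delta\epsilon_k}\in T_{\epsilon_k}E$ ($1\le k\le N-1$): $\delta\epsilon_{N-1}=\widetilde{\delta\epsilon_{N-1}}$, $\delta\epsilon_k=\widetilde{\delta\epsilon_k}+\mathcal P((\epsilon_k,m_{k+1}),(\epsilon_{k+1},m_{k+2}))(\widetilde{\delta\epsilon_{k+1}})$ for $1\le k\le N-2$, $\delta\epsilon_0=\mathcal P((\epsilon_0,m_1),(\epsilon_1,m_2))(\widetilde{\delta\epsilon_1})$. The path is a trajectory if $d(\sum_{k=0}^{N-1} L(\epsilon_k,m_{k+1}))$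 vanishes on all infinitesimal variations with fixed endpoints. In $\mathcal M=(\tilde G,\check L_d,\mathcal P)$ (fiber bundle $p^{Q/G}:\tilde G\to Q/G$), $\mathcal P((v_0,r_1),(v_1,r_2))(\delta v_1):=D_2(p_1\circ\Upsilon_{\mathcal A_d})(q_0,q_1)(\delta q_1)$, where $q_0,q_1,q_2\in Q$ satisfy $\Upsilon_{\mathcal A_d}(q_0,q_1)=(v_0,r_1)$, $\Upsilon_{\mathcal A_d}(q_1,q_2)=(v_1,r_2)$ and $\delta q_1\in T_{q_1}Q$ is the unique vector with $D_1(p_1\circ\Upsilon_{\mathcal A_d})(q_1,q_2)(\delta q_1)=\delta v_1$ (well defined). *)

(* Defs.v *)
From HB Require Import structures.
From mathcomp Require Import all_boot all_order all_algebra.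
From mathcomp Require Import all_classical all_reals topology normedtype landau derive.
Import Order.TTheory GRing.Theory Num.Theory.
Import numFieldNormedType.Exports.

Set Implicit Arguments.
Unset Strict Implicit.
Unset Printing Implicit Defensive.

Local Open Scope classical_set_scope.
Local Open Scope ring_scope.
Local Open Scope quotient_scope.

Definition prod_map (A B C D : Type) (f : A -> C) (g : B -> D) :
  A * B -> C * D := fun q => (f q.1, g q.2).

Section smooth_vector.
Variable R : realType.
Implicit Types V W : normedModType R.

Definition fin_dim V := exists n (b : 'I_n -> V),
  forall v, exists a : 'I_n -> R, v = \sum_(i < n) a i *: b i.

(* On an open subset of a finite-dimensional space, f is C^(k+1) if and only
   if it is differentiable and x |-> df(x)(v) is C^k for each vector v. *)
Fixpoint Ck (k : nat) V W (U : set V) (f : V -> W) : Prop :=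
  if k is k'.+1 then
    (forall x, U x -> differentiable f x) /\
    (forall v, Ck k' U (fun x => 'd f x v))
  else forall x, U x -> {for x, continuous f}.

Definition smooth_on V W (U : set V) (f : V -> W) := forall k, Ck k U f.

Lemma diff_ext V W (U : set V) (f g : V -> W) x : open U -> U x ->
  (forall y, U y -> f y = g y) -> differentiable f x ->
  differentiable g x /\ 'd g x = 'd f x :> (V -> W).
Proof.
move=> oU Ux fg df.
have nU : \forall h \near 0, U (h + x).
  have : nbhs x U by exact: open_nbhs_nbhs.
  by rewrite -[nbhs x U]/(\forall z \near x, U z) (near_shift 0 x) subr0.
have E : g \o shift x = cst (g x) + 'd f x +o_ 0 id.
  apply/eqaddoP => e e0; near=> h.
  rewrite !fctE /= -!fg//; last by near: h.
  by near: h; move/diff_locally : df => /eqaddoP /(_ e e0).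
have dE := diff_unique (diff_continuous df) E.
split=> //; apply/diff_locallyP; rewrite dE; split=> //.
exact: diff_continuous.
Unshelve. all: by end_near. Qed.

Lemma Ck_ext k V W (U : set V) (f g : V -> W) : open U ->
  (forall y, U y -> f y = g y) -> Ck k U f -> Ck k U g.
Proof.
elim: k f g => [|k IH] f g oU fg /=.
  move=> cf x Ux; have := cf x Ux.
  rewrite /prop_for/continuous_at -fg//; apply: cvg_trans.
  apply: near_eq_cvg; apply: (filterS _ (open_nbhs_nbhs (conj oU Ux))).
  by move=> y /fg.
move=> [df cdf]; split=> [x Ux|v].
  by have [] := diff_ext oU Ux fg (df x Ux).
apply: (IH _ _ oU _ (cdf v)) => y Uy.
by have [_ ->] := diff_ext oU Uy fg (df y Uy).
Qed.

Lemma Ck_cst k V W (U : set V) (a : W) : Ck k U (cst a).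
Proof.
elim: k a => [|k IH] a /=; first by move=> x _; exact: cst_continuous.
split=> [x _|v]; first exact: differentiable_cst.
by under eq_fun do rewrite diff_cst; exact: IH.
Qed.

Lemma Ck_id k V (U : set V) : Ck k U id.
Proof.
case: k => [|k] /=; first by move=> x _; exact: cvg_id.
split=> [x _|v]; first by [].
under eq_fun do rewrite diff_val; exact: Ck_cst.
Qed.

Lemma differentiable_prod V1 V2 W1 W2 (f : V1 -> W1) (g : V2 -> W2)
    (p : V1 * V2) :
  differentiable f p.1 -> differentiable g p.2 ->
  differentiable (prod_map f g) p /\
  'd (prod_map f g) p = prod_map ('d f (p.1)) ('d g (p.2)) :> (V1 * V2 -> W1 * W2).
Proof.
move=> df dg.
have c1 : continuous (fst : V1 * V2 -> V1) by move=> x; exact: cvg_fst.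
have c2 : continuous (snd : V1 * V2 -> V2) by move=> x; exact: cvg_snd.
have d1 : is_diff p (fst : V1 * V2 -> V1) fst.
  by apply: DiffDef; [exact: linear_differentiable|rewrite diff_lin].
have d2 : is_diff p (snd : V1 * V2 -> V2) snd.
  by apply: DiffDef; [exact: linear_differentiable|rewrite diff_lin].
have F : is_diff p (f \o fst) ('d f (p.1) \o fst).
  by apply: is_diff_comp; apply: differentiableP.
have G : is_diff p (g \o snd) ('d g (p.2) \o snd).
  by apply: is_diff_comp; apply: differentiableP.
have H : is_diff p (prod_map f g) (prod_map ('d f (p.1)) ('d g (p.2))).
  exact: is_diff_pair.
by split; [exact: ex_diff|rewrite diff_val].
Qed.

Lemma open_setX (S T : topologicalType) (A : set S) (B : set T) :
  open A -> open B -> open (A `*` B).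
Proof.
rewrite !openE => oA oB [x y] [/= /oA Ax /oB By].
by exists (A, B).
Qed.

Lemma Ck_prod k V1 V2 W1 W2 (U1 : set V1) (U2 : set V2)
    (f : V1 -> W1) (g : V2 -> W2) : open U1 -> open U2 ->
  Ck k U1 f -> Ck k U2 g -> Ck k (U1 `*` U2) (prod_map f g).
Proof.
elim: k f g => [|k IH] f g o1 o2 /=.
  move=> cf cg x [/= x1 x2]; apply: cvg_pair => /=.
    by apply: (cvg_comp _ _ cvg_fst); exact: cf.
  by apply: (cvg_comp _ _ cvg_snd); exact: cg.
move=> [df cf] [dg cg]; split=> [x [x1 x2]|v].
  by have [] := differentiable_prod (df _ x1) (dg _ x2).
apply: (@Ck_ext _ _ _ _
  (prod_map (fun x => 'd f x v.1) (fun x => 'd g x v.2))).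
- exact: open_setX.
- move=> y [y1 y2].
  by have [_ ->] := differentiable_prod (df _ y1) (dg _ y2).
- exact: IH.
Qed.

End smooth_vector.

Section fin_dim.
Variable R : realType.
Implicit Types V W : normedModType R.

Lemma fin_dim_prod V W : fin_dim V -> fin_dim W -> fin_dim (V * W)%type.
Proof.
move=> [n [b bP]] [m [c cP]].
exists (n + m)%N, (fun i : 'I_(n + m) => match fintype.split i with
  | inl j => (b j, 0) | inr j => (0, c j) end).
move=> [v w]; have [a ->] := bP v; have [d ->] := cP w.
exists (fun i : 'I_(n + m) => match fintype.split i with inl j => a j | inr j => d j end).
have spl k (i : 'I_n) : fintype.split (lshift k i) = inl i.
  exact: (unsplitK (inl i)).
have spr k (i : 'I_m) : fintype.split (rshift k i) = inr i.
  exact: (unsplitK (inr i)).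
rewrite big_split_ord.
under eq_bigr => i _ do rewrite spl.
under [X in _ = _ + X]eq_bigr => i _ do rewrite spr.
rewrite [RHS]surjective_pairing /= !raddf_sum /=; congr pair.
- by rewrite [X in _ + X]big1 ?addr0// => i _; exact: scaler0.
- by rewrite [X in X + _]big1 ?add0r// => i _; exact: scaler0.
Qed.

Lemma fin_dim_scalar : fin_dim R^o.
Proof.
exists 1%N, (fun=> 1) => v; exists (fun=> v).
by rewrite big_ord1 /GRing.scale/= mulr1.
Qed.

Lemma fin_dim_second_countable V : fin_dim V -> @second_countable V.
Proof.
move=> [n [b bP]].
pose x_ (a : {ffun 'I_n -> rat}) : V := \sum_(i < n) ratr (a i) *: b i.
pose f (p : {ffun 'I_n -> rat} * nat) := (ball (x_ p.1) p.2.+1%:R^-1 : set V).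
exists (range f); first by apply: (card_le_trans (card_image_le _ _)); exact: countableP.
split; first by move=> _ [p _ <-]; exact: ball_open.
move=> v U /nbhs_ballP[e /= e0 eU].
have [N] := @ltr_add_invr R 0 (e / 2) (divr_gt0 e0 (ltr0Sn _ 1)); rewrite add0r => Ne.
have [a av] := bP v.
pose M := \sum_(i < n) `|b i| + 1.
have M0 : 0 < M by rewrite ltr_wpDl// sumr_ge0.
have /= H i : exists q : rat, `|a i - ratr q| < N.+1%:R^-1 / M.
  have d0 : 0 < N.+1%:R^-1 / M :> R by rewrite divr_gt0 ?invr_gt0 ?ltr0Sn.
  have : a i < a i + N.+1%:R^-1 / M by rewrite ltrDl.
  move=> /rat_in_itvoo[q]; rewrite in_itv/= => /andP[aq qa].
  by exists q; rewrite ler0_norm ?subr_le0 ?ltW// opprB ltrBlDl.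
have {H}[q qP] := choice H.
have xv : ball (x_ (finfun q)) N.+1%:R^-1 v.
  rewrite -ball_normE/= /x_ av distrC -sumrB.
  apply: (@le_lt_trans _ _ (\sum_(i < n) N.+1%:R^-1 / M * `|b i|)).
    apply: (le_trans (ler_norm_sum _ _ _)); apply: ler_sum => i _.
    by rewrite ffunE -scalerBl normrZ ler_wpM2r// ltW.
  rewrite -mulr_sumr -mulrA gtr_pMr ?invr_gt0 ?ltr0Sn// mulrC ltr_pdivrMr// mul1r.
  by rewrite /M ltrDl.
exists (ball (x_ (finfun q)) N.+1%:R^-1).
  by split => //; exists (finfun q, N).
move=> y By; apply: eU.
rewrite (splitr e); apply: (@ball_triangle _ _ (x_ (finfun q))).
  by apply: (le_ball (ltW Ne)); apply: ball_sym.
exact: (le_ball (ltW Ne)).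
Qed.

End fin_dim.

Lemma hausdorff_prod (S T : topologicalType) :
  hausdorff_space S -> hausdorff_space T -> hausdorff_space (S * T)%type.
Proof.
move=> hS hT [x1 x2] [y1 y2] cl; congr pair.
- apply: hS => A B xA yB.
  have [] := cl (A `*` setT) (B `*` setT).
  + by exists (A, setT) => //; split => //; exact: filterT.
  + by exists (B, setT) => //; split => //; exact: filterT.
  + by move=> [z ?] [[? _] [? _]]; exists z.
- apply: hT => A B xA yB.
  have [] := cl (setT `*` A) (setT `*` B).
  + by exists (setT, A) => //; split => //; exact: filterT.
  + by exists (setT, B) => //; split => //; exact: filterT.
  + by move=> [? z] [[_ ?] [_ ?]]; exists z.
Qed.

Lemma second_countable_prod (S T : topologicalType) :
  @second_countable S -> @second_countable T -> @second_countable (S * T)%type.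
Proof.
move=> [B cB [oB bB]] [C cC [oC bC]].
exists ((fun p => p.1 `*` p.2) @` (B `*` C)).
  by apply: (card_le_trans (card_image_le _ _)); exact: countableX.
split.
  by move=> _ [[U V] [/= /oB oU /oC oV] <-]; exact: open_setX.
move=> [x y] W [[P1 P2] /= [xP1 yP2] PW].
have [U [BU Ux] UP] := bB x _ xP1.
have [V [CV Vy] VP] := bC y _ yP2.
exists (U `*` V).
  by split => //; exists (U, V).
by move=> [u v] [/= /UP ? /VP ?]; exact: PW.
Qed.

Section manifold_def.
Variable R : realType.

Record chart (T : topologicalType) (V : normedModType R) := Chart {
  dom : set T;
  fwd : T -> V;
  bwd : V -> T;
  open_dom : open dom;
  open_cod : open (fwd @` dom);
  chartK : forall x, dom x -> bwd (fwd x) = x;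
  fwd_continuous : forall x, dom x -> {for x, continuous fwd};
  bwd_continuous : forall u, (fwd @` dom) u -> {for u, continuous bwd} }.

Definition cod T V (c : chart T V) : set V := fwd c @` dom c.

(* Hausdorff and second countable, of pure dimension: all the charts take
   values in one finite-dimensional model space. Each point has a preferred
   chart in the atlas, in which its tangent vectors are read below. *)
Record smooth_structure (T : topologicalType) := SmoothStructure {
  model : normedModType R;
  model_fin_dim : fin_dim model;
  atlas : set (chart T model);
  chart_at : T -> chart T model;
  chart_at_atlas : forall x, atlas (chart_at x);
  chart_at_dom : forall x, dom (chart_at x) x;
  atlas_compatible : forall c d, atlas c -> atlas d ->
    smooth_on [set u | cod c u /\ dom d (bwd c u)] (fwd d \o bwd c);
  manifold_hausdorff : hausdorff_space T;
  manifold_second_countable : @second_countable T }.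

Record manifold := Manifold {
  space :> topologicalType;
  structure :> smooth_structure space }.

End manifold_def.

Arguments chart_at {R T} s x.
Arguments atlas {R T} s.

Section product_manifold.
Variable R : realType.

Section prod_chart.
Variables (S T : topologicalType) (V W : normedModType R).
Variables (c : chart S V) (d : chart T W).

Let pfwd := prod_map (fwd c) (fwd d).
Let pbwd := prod_map (bwd c) (bwd d).
Let pdom := dom c `*` dom d.

Let cod_pfwd : pfwd @` pdom = cod c `*` cod d.
Proof.
apply/seteqP; split=> [_ [p [p1 p2] <-]|[u v] [/= [x cx <-] [y dy <-]]].
  by split; [exists p.1|exists p.2].
by exists (x, y).
Qed.

Lemma prod_map_continuous (A B C D : topologicalType) (f : A -> C) (g : B -> D)
    (p : A * B) : {for p.1, continuous f} -> {for p.2, continuous g} ->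
  {for p, continuous (prod_map f g)}.
Proof.
move=> cf cg; apply: cvg_pair => /=.
- exact: (cvg_comp _ _ cvg_fst).
- exact: (cvg_comp _ _ cvg_snd).
Qed.

Fact prod_open_dom : open pdom.
Proof. by apply: open_setX; exact: open_dom. Qed.

Fact prod_open_cod : open (pfwd @` pdom).
Proof. by rewrite cod_pfwd; apply: open_setX; exact: open_cod. Qed.

Fact prod_chartK p : pdom p -> pbwd (pfwd p) = p.
Proof. by move: p => [x y] [/= cx dy]; congr pair; exact: chartK. Qed.

Fact prod_fwd_continuous p : pdom p -> {for p, continuous pfwd}.
Proof. by move=> [? ?]; apply: prod_map_continuous; exact: fwd_continuous. Qed.

Fact prod_bwd_continuous u : (pfwd @` pdom) u -> {for u, continuous pbwd}.
Proof.
by rewrite cod_pfwd => -[? ?]; apply: prod_map_continuous; exact: bwd_continuous.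
Qed.

Definition prod_chart : chart (S * T)%type (V * W)%type :=
  Chart prod_open_dom prod_open_cod prod_chartK prod_fwd_continuous
    prod_bwd_continuous.

Lemma cod_prod_chart : cod prod_chart = cod c `*` cod d.
Proof. exact: cod_pfwd. Qed.

End prod_chart.

Lemma open_overlap (T : topologicalType) (V : normedModType R)
    (c d : chart T V) : open [set u | cod c u /\ dom d (bwd c u)].
Proof.
rewrite openE => u [cu du]; apply: filterI.
  by apply: open_nbhs_nbhs; split=> //; exact: open_cod.
apply: (bwd_continuous cu); apply: open_nbhs_nbhs.
by split=> //; exact: open_dom.
Qed.

Variables M N : manifold R.

Definition prod_atlas : set (chart (M * N)%type (model M * model N)%type) :=
  [set e | exists c d, [/\ atlas M c, atlas N d & e = prod_chart c d]].

Fact prod_chart_at_atlas (x : M * N) :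
  prod_atlas (prod_chart (chart_at M x.1) (chart_at N x.2)).
Proof. by exists (chart_at M x.1), (chart_at N x.2); split=> //; exact: chart_at_atlas. Qed.

Fact prod_chart_at_dom (x : M * N) :
  dom (prod_chart (chart_at M x.1) (chart_at N x.2)) x.
Proof. by split; exact: chart_at_dom. Qed.

Fact prod_atlas_compatible e f : prod_atlas e -> prod_atlas f ->
  smooth_on [set u | cod e u /\ dom f (bwd e u)] (fwd f \o bwd e).
Proof.
move=> [c [d [Ac Ad ->]]] [c' [d' [Ac' Ad' ->]]] k.
rewrite cod_prod_chart.
have -> : [set u | (cod c `*` cod d) u /\
      dom (prod_chart c' d') (bwd (prod_chart c d) u)] =
    [set u | cod c u /\ dom c' (bwd c u)] `*`
    [set u | cod d u /\ dom d' (bwd d u)].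
  by apply/seteqP; split=> [[u v] [[? ?] [? ?]]|[u v] [[? ?] [? ?]]].
apply: (@Ck_prod _ k _ _ _ _ _ _ (fwd c' \o bwd c) (fwd d' \o bwd d)).
- exact: open_overlap.
- exact: open_overlap.
- exact: atlas_compatible.
- exact: atlas_compatible.
Qed.

Definition prod_manifold : manifold R := Manifold (SmoothStructure
  (fin_dim_prod (model_fin_dim M) (model_fin_dim N))
  prod_chart_at_atlas prod_chart_at_dom prod_atlas_compatible
  (hausdorff_prod (@manifold_hausdorff _ _ M) (@manifold_hausdorff _ _ N))
  (second_countable_prod (@manifold_second_countable _ _ M)
     (@manifold_second_countable _ _ N))).

End product_manifold.

Section vector_manifold.
Variables (R : realType) (V : normedModType R) (fV : fin_dim V).

Let id_cod : id @` [set: V] = setT. Proof. by rewrite image_id. Qed.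

Fact id_open_cod : open (id @` [set: V]).
Proof. by rewrite id_cod; exact: openT. Qed.

Definition id_chart : chart V V := @Chart R V V setT id id openT id_open_cod
  (fun _ _ => erefl) (fun _ _ => cvg_id) (fun _ _ => cvg_id).

Fact id_atlas_compatible c d : [set id_chart] c -> [set id_chart] d ->
  smooth_on [set u | cod c u /\ dom d (bwd c u)] (fwd d \o bwd c).
Proof. by move=> -> -> k; exact: Ck_id. Qed.

Definition vector_manifold : manifold R := Manifold (@SmoothStructure R V V fV
  [set id_chart] (fun=> id_chart) (fun=> erefl) (fun=> I) id_atlas_compatible
  (@norm_hausdorff R V) (fin_dim_second_countable fV)).

End vector_manifold.

Definition real_line (R : realType) : manifold R :=
  vector_manifold (fin_dim_scalar R).

Section smooth_maps.
Variable R : realType.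
Implicit Types M N Z : manifold R.

Definition smooth_map_on M N (A : set M) (f : M -> N) :=
  (forall x, A x -> {for x, continuous f}) /\
  (forall c d, atlas M c -> atlas N d ->
    smooth_on [set u | [/\ cod c u, A (bwd c u) & dom d (f (bwd c u))]]
      (fwd d \o f \o bwd c)).

Definition smooth_map M N (f : M -> N) := smooth_map_on setT f.

(* T_x M, read in the preferred chart at x *)
Definition tangent M (x : M) : normedModType R := model M.

Definition differential M N (f : M -> N) (x : M) :
    {linear tangent x -> tangent (f x)} :=
  'd (fwd (chart_at N (f x)) \o f \o bwd (chart_at M x))
     (fwd (chart_at M x) x).

Definition D1 M N Z (f : prod_manifold M N -> Z) (x : M) (y : N)
  (v : tangent x) : tangent (f (x, y)) := differential f (x, y) (v, 0).

Definition D2 M N Z (f : prod_manifold M N -> Z) (x : M) (y : N)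
  (w : tangent y) : tangent (f (x, y)) := differential f (x, y) (0, w).

Definition submersion M N (f : M -> N) := smooth_map f /\
  forall x (w : tangent (f x)), exists v, differential f x v = w.

Definition embedding M N (f : M -> N) := [/\ smooth_map f,
  forall x, injective (differential f x), injective f &
  forall U : set M, open U -> exists2 V : set N, open V & U = f @^-1` V].

(* f restricts to a diffeomorphism from U onto V with inverse g *)
Definition diffeo_between M N (U : set M) (V : set N) (f : M -> N) (g : N -> M) :=
  [/\ open U, open V,
      smooth_map_on U f /\ smooth_map_on V g,
      forall x, U x -> V (f x) /\ g (f x) = x &
      forall y, V y -> U (g y) /\ f (g y) = y].

Definition local_diffeo M N (f : M -> N) := forall x,
  exists U V g, U x /\ diffeo_between U V f g.

Definition fiber_bundle M N (p : M -> N) :=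
  [/\ smooth_map p, forall y, exists x, p x = y &
    exists F : manifold R, forall y, exists U : set N, [/\ open U, U y &
      exists (f : M -> prod_manifold N F) g,
        diffeo_between (p @^-1` U)
          (U `*` [set: F] : set (prod_manifold N F)) f g /\
        forall x, U (p x) -> (f x).1 = p x]].

End smooth_maps.

Section group_actions.
Variable R : realType.

Record lie_group := LieGroup {
  lie_manifold :> manifold R;
  lmul : lie_manifold -> lie_manifold -> lie_manifold;
  lone : lie_manifold;
  linv : lie_manifold -> lie_manifold;
  lmulA : associative lmul;
  lmul1 : left_id lone lmul;
  lmulV : left_inverse lone linv lmul;
  lmul_smooth : smooth_map (fun p : prod_manifold lie_manifold lie_manifold =>
    lmul p.1 p.2);
  linv_smooth : smooth_map linv }.

Variable G : lie_group.

Lemma rmulV : right_inverse (lone G) (@linv G) (@lmul G).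
Proof.
move=> g; set h := linv g.
by rewrite -[lmul g h]lmul1 -{1}(lmulV h) -lmulA [lmul h (lmul g h)]lmulA lmulV
  lmul1 lmulV.
Qed.

Lemma rmul1 : right_id (lone G) (@lmul G).
Proof. by move=> g; rewrite -(lmulV g) lmulA rmulV lmul1. Qed.

Lemma linvM (g h : G) : linv (lmul g h) = lmul (linv h) (linv g).
Proof.
have : lmul (lmul (linv h) (linv g)) (lmul g h) = lone G.
  by rewrite -lmulA [lmul _ (lmul g h)]lmulA lmulV lmul1 lmulV.
move=> /(congr1 (@lmul G ^~ (linv (lmul g h)))).
by rewrite -lmulA rmulV rmul1 lmul1.
Qed.

Record action (X : manifold R) := Action {
  act :> G -> X -> X;
  act1 : forall x, act (lone G) x = x;
  actM : forall g h x, act (lmul g h) x = act g (act h x) }.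

Section orbits.
Variables (X : manifold R) (l : action X).

Definition same_orbit : rel X := fun x y => `[< exists g, y = l g x >].

Fact same_orbit_refl : reflexive same_orbit.
Proof. by move=> x; apply/asboolP; exists (lone G); rewrite act1. Qed.

Fact same_orbit_sym : symmetric same_orbit.
Proof.
move=> x y; apply/asbool_equiv_eq.
by split=> -[g ->]; exists (linv g); rewrite -actM lmulV act1.
Qed.

Fact same_orbit_trans : transitive same_orbit.
Proof.
move=> y x z /asboolP[g ->] /asboolP[h ->].
by apply/asboolP; exists (lmul h g); rewrite actM.
Qed.

Canonical same_orbit_equiv :=
  EquivRel same_orbit same_orbit_refl same_orbit_sym same_orbit_trans.

(* X/G, with the quotient topology *)
Definition orbit_space : topologicalType :=
  quotient_topology {eq_quot same_orbit_equiv}.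

Definition orbit_proj : X -> orbit_space := \pi_({eq_quot same_orbit_equiv})%qT.

Lemma orbit_projP x y : orbit_proj x = orbit_proj y <-> exists g, y = l g x.
Proof. by split=> [/eqmodP/asboolP//|?]; apply/eqmodP/asboolP. Qed.

End orbits.
End group_actions.

Section bundles.
Variables (R : realType) (G : lie_group R).

Definition smooth_action (X : manifold R) (l : action G X) :=
  smooth_map (fun p : prod_manifold G X => l p.1 p.2).

Definition free_action (X : manifold R) (l : action G X) :=
  forall g x, l g x = x -> g = lone G.

Definition principal_bundle (X B : manifold R) (l : action G X) (p : X -> B) :=
  [/\ submersion p /\ (forall b, exists x, p x = b), smooth_action l,
      free_action l & forall x y, p x = p y <-> exists g, y = l g x].

Variables (Q : manifold R) (l : action G Q).

Definition symmetry_group (B : manifold R) (p : Q -> B)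
    (Ld : prod_manifold Q Q -> real_line R) :=
  principal_bundle l p /\
  forall g q0 q1, Ld (l g q0, l g q1) = Ld (q0, q1).

(* The submanifold Hor of Q x Q is given by an embedding, whose range is the
   subset in question. *)
Record discrete_connection (B : manifold R) (p : Q -> B) := DiscreteConnection {
  hor : manifold R;
  hor_incl : hor -> prod_manifold Q Q;
  hor_embedding : embedding hor_incl;
  hor_invariant : forall g h, range hor_incl
    (l g (hor_incl h).1, l g (hor_incl h).2);
  hor_diagonal : forall q, range hor_incl (q, q);
  hor_proj : hor -> prod_manifold Q B :=
    fun h => ((hor_incl h).1, p (hor_incl h).2);
  hor_proj_injective : injective hor_proj;
  hor_proj_local_diffeo : local_diffeo hor_proj;
  hor_proj_surjective : forall y, exists h, hor_proj h = y;
  conn : prod_manifold Q Q -> G;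
  connP : forall q0 q1 g,
    range hor_incl (q0, l (linv g) q1) <-> g = conn (q0, q1);
  conn_smooth : smooth_map conn }.

Definition twisted_act (g : G) (x : prod_manifold Q G) : prod_manifold Q G :=
  (l g x.1, lmul (lmul g x.2) (linv g)).

Fact twisted_act1 x : twisted_act (lone G) x = x.
Proof.
case: x => q w; rewrite /twisted_act /= act1 lmul1; congr pair.
by rewrite -[X in lmul _ X]lmul1 rmulV rmul1.
Qed.

Fact twisted_actM g h x :
  twisted_act (lmul g h) x = twisted_act g (twisted_act h x).
Proof. by rewrite /twisted_act /= actM linvM !lmulA. Qed.

Definition twisted_action : action G (prod_manifold Q G) :=
  Action twisted_act1 twisted_actM.

(* p^{Q/G} *)
Definition twisted_proj : orbit_space twisted_action -> orbit_space l :=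
  fun v => orbit_proj l (repr (v : {eq_quot same_orbit_equiv twisted_action})).1.

Lemma twisted_projE q w :
  twisted_proj (orbit_proj twisted_action (q, w)) = orbit_proj l q.
Proof.
rewrite /twisted_proj; set r := repr _.
have /orbit_projP[g /(congr1 fst)/= ->] :
  orbit_proj twisted_action r = orbit_proj twisted_action (q, w).
  by rewrite /orbit_proj reprK.
by apply/orbit_projP; exists g.
Qed.

End bundles.

Arguments twisted_proj {R G Q} l v.

Section lagrange_poincare.
Variables (R : realType) (E M : manifold R) (phi : E -> M).

Let C' := prod_manifold E M.

(* ((e0, m1), (e1, m2)) belongs to C''(E) *)
Definition second_order (x y : C') := x.2 = phi y.1.

(* C''(E) is identified with E x E x M through its coordinates (e0, e1, m2),
   and both tangent spaces are trivialized by charts of E. *)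
Definition smooth_family
    (P : forall x y : C', {linear tangent y.1 -> tangent x.1}) :=
  forall c d, atlas E c -> atlas E d -> forall v : model E,
    smooth_map_on
      ([set t | dom c t.1.1 /\ dom d t.1.2] :
         set (prod_manifold (prod_manifold E E) M))
      (fun t => differential (fwd c : E -> vector_manifold (model_fin_dim E))
         t.1.1
         (P (t.1.1, phi t.1.2) (t.1.2, t.2)
            (differential (bwd d : vector_manifold (model_fin_dim E) -> E)
               (fwd d t.1.2) v))
       : vector_manifold (model_fin_dim E)).

(* Only the values of [dlp_map] on C''(E) are relevant. *)
Record dlp_system := DLPSystem {
  dlp_bundle : fiber_bundle phi;
  dlp_lagrangian : C' -> real_line R;
  dlp_lagrangian_smooth : smooth_map dlp_lagrangian;
  dlp_map : forall x y : C', {linear tangent y.1 -> tangent x.1};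
  dlp_map_vertical : forall x y, second_order x y ->
    forall v, differential phi x.1 (dlp_map x y v) = 0;
  dlp_map_smooth : smooth_family dlp_map }.

End lagrange_poincare.

(* Sequences indexed by 0, ..., n are represented by functions on nat, whose
   values beyond n are ignored. *)
Section discrete_action.
Variable R : realType.

(* M^(n+1) *)
Fixpoint power_manifold (M : manifold R) n : manifold R :=
  if n is n'.+1 then prod_manifold M (power_manifold M n') else M.

Fixpoint power_point (M : manifold R) n (x : nat -> M) : power_manifold M n :=
  if n is n'.+1 then (x 0%N, power_point n' (fun k => x k.+1)) else x 0%N.

Fixpoint power_tangent (M : manifold R) n (x : nat -> M)
    (v : forall k, tangent (x k)) : tangent (power_point n x) :=
  if n is n'.+1 then (v 0%N, power_tangent n' (fun k => v k.+1)) else v 0%N.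

Fixpoint power_sum (M : manifold R) (L : M -> real_line R) n :
    power_manifold M n -> real_line R :=
  if n is n'.+1 then fun x => L x.1 + power_sum L x.2 else L.

Lemma power_sumE (M : manifold R) (L : M -> real_line R) n (x : nat -> M) :
  power_sum L (power_point n x) = \sum_(k < n.+1) (L (x k) : R^o).
Proof.
elim: n x => [|n IHn] x /=; first by rewrite big_ord1.
by rewrite big_ord_recl IHn.
Qed.

End discrete_action.

Section trajectories.
Variables (R : realType) (E M : manifold R) (phi : E -> M).

Let C' := prod_manifold E M.

Definition discrete_path (N : nat) (c : nat -> C') :=
  forall k, (k.+1 < N)%N -> second_order phi (c k) (c k.+1).

(* d(\sum_(k < N) L (c k)), applied to the vectors dc k *)
Definition action_differential (L : C' -> real_line R) (N : nat)
    (c : nat -> C') (dc : forall k, tangent (c k)) :=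
  differential (@power_sum _ _ L N.-1) (power_point N.-1 c) (power_tangent N.-1 dc).

(* c k is (e_k, m_(k+1)) and dc k is (de_k, dm_(k+1)). *)
Definition fixed_endpoints_variation (S : dlp_system phi) (N : nat)
    (c : nat -> C') (dc : forall k, tangent (c k)) :=
  [/\ forall k, (k.+1 < N)%N ->
        (dc k).2 = differential phi (c k.+1).1 (dc k.+1).1,
      (dc N.-1).2 = 0 &
      exists w : forall k, tangent (c k).1,
      [/\ (dc N.-1).1 = w N.-1,
          forall k, (0 < k)%N -> (k.+1 < N)%N ->
            (dc k).1 = w k + dlp_map S (c k) (c k.+1) (w k.+1) &
          (dc 0%N).1 = dlp_map S (c 0%N) (c 1%N) (w 1%N)]].

Definition trajectory (S : dlp_system phi) (N : nat) (c : nat -> C') :=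
  discrete_path N c /\
  forall dc : forall k, tangent (c k), fixed_endpoints_variation S N dc ->
    action_differential (@dlp_lagrangian _ _ _ _ S) N dc = 0.

End trajectories.

Section reduction.
Variable R : realType.

Definition quotient_manifold (G : lie_group R) (X : manifold R)
    (l : action G X) (s : smooth_structure R (orbit_space l)) : manifold R :=
  Manifold s.

Variables (G : lie_group R) (Q : manifold R) (l : action G Q).
Variable sB : smooth_structure R (orbit_space l).
Variable sT : smooth_structure R (orbit_space (twisted_action l)).

Let B := quotient_manifold sB.
Let T := quotient_manifold sT.

Variable A : discrete_connection l (orbit_proj l : Q -> B).

Definition Upsilon : prod_manifold Q Q -> prod_manifold T B := fun x =>
  (orbit_proj (twisted_action l) (x.1, conn A x), orbit_proj l x.2).

Definition Upsilon1 : prod_manifold Q Q -> T := fun x => (Upsilon x).1.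

(* Upsilon is onto and D1 Upsilon1 is invertible, so these equations determine
   the Lagrangian and, on C''(E), the family of linear maps. *)
Definition associated_dlp_system (Ld : prod_manifold Q Q -> real_line R)
    (S : dlp_system (twisted_proj l : T -> B)) :=
  (forall x, dlp_lagrangian S (Upsilon x) = Ld x) /\
  forall q0 q1 q2 (dq : tangent q1),
    dlp_map S (Upsilon (q0, q1)) (Upsilon (q1, q2)) (D1 Upsilon1 q2 dq) =
    D2 Upsilon1 q0 dq.

Definition reduced_path (q : nat -> Q) : nat -> prod_manifold T B :=
  fun k => Upsilon (q k, q k.+1).

Definition reduced_trajectory (L : prod_manifold T B -> real_line R) (N : nat)
    (q : nat -> Q) :=
  forall dq : forall k, tangent (q k), dq 0%N = 0 -> dq N = 0 ->
    action_differential L N (fun k =>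
      differential Upsilon (q k, q k.+1) (dq k, dq k.+1)
      : tangent (reduced_path q k)) = 0.

End reduction.

(* Main.v *)
(* Both classes of variations coincide. Differentiating the first component of
   [Upsilon] along [(dq_k, dq_(k+1))] gives [w_k + P(w_(k+1))] with
   [w_k = D1 Upsilon1 (dq_k)], and the base components agree since the bundle
   projection composed with [Upsilon1] sends [(q_k, q_(k+1))] to the orbit of
   [q_k]. Conversely the [w_k] of a given variation lift to vectors [dq_k]
   because [D1 Upsilon1] is onto: as [conn A (h q0, q1) = conn A (q0, q1) h^-1],
   the orbit projection [Q x G -> (Q x G)/G] factors smoothly through
   [Upsilon1 (_, q1)], and it is a submersion. *)
Require Import Defs.
From mathcomp Require Import all_boot all_order all_algebra.
From mathcomp Require Import all_classical all_reals topology normedtype landau derive.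
Import Order.TTheory GRing.Theory Num.Theory.
Import numFieldNormedType.Exports.

Set Implicit Arguments.
Unset Strict Implicit.
Unset Printing Implicit Defensive.

Local Open Scope classical_set_scope.
Local Open Scope ring_scope.

(** * Pointwise differential calculus in the preferred charts *)

Section differentials.
Variable R : realType.
Implicit Types M N P : manifold R.

Definition local_rep M N (f : M -> N) (x : M) : model M -> model N :=
  fwd (chart_at N (f x)) \o f \o bwd (chart_at M x).

(** Continuity is a separate clause because [fwd] is arbitrary off its chart domain: a
    differentiable representative alone does not keep [f] inside the chart at [f x]. *)
Definition mdifferentiable M N (f : M -> N) (x : M) :=
  {for x, continuous f} /\
  differentiable (local_rep f x) (fwd (chart_at M x) x).

Lemma near_diff_ext (V W : normedModType R) (f g : V -> W) x :
  (\forall y \near x, f y = g y) -> differentiable f x ->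
  differentiable g x /\ 'd g x = 'd f x :> (V -> W).
Proof.
move=> fg; apply: (@diff_ext _ _ _ [set y | f y = g y]°).
- exact: open_interior.
- exact: fg.
- exact: interior_subset.
Qed.

Lemma bwd_fwd_at M (x : M) : bwd (chart_at M x) (fwd (chart_at M x) x) = x.
Proof. by apply: chartK; exact: chart_at_dom. Qed.

Lemma cod_fwd_at M (x : M) : cod (chart_at M x) (fwd (chart_at M x) x).
Proof. by exists x => //; exact: chart_at_dom. Qed.

Lemma near_dom_bwd M N (f : M -> N) (x : M) : {for x, continuous f} ->
  \forall u \near fwd (chart_at M x) x,
    dom (chart_at N (f x)) (f (bwd (chart_at M x) u)).
Proof.
move=> cf.
have cfb : {for fwd (chart_at M x) x, continuous (f \o bwd (chart_at M x))}.
  apply: continuous_comp; first exact: bwd_continuous (cod_fwd_at x).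
  by rewrite bwd_fwd_at.
apply: cfb; apply: open_nbhs_nbhs; split; first exact: open_dom.
by rewrite /= bwd_fwd_at; exact: chart_at_dom.
Qed.

Lemma near_fwdK M (x : M) : \forall u \near fwd (chart_at M x) x,
  fwd (chart_at M x) (bwd (chart_at M x) u) = u.
Proof.
have: nbhs (fwd (chart_at M x) x) (cod (chart_at M x)).
  by apply: open_nbhs_nbhs; split; [exact: open_cod|exact: cod_fwd_at].
apply: filterS => _ [y dy <-]; by rewrite chartK.
Qed.

Lemma smooth_mdifferentiable M N (f : M -> N) x :
  smooth_map f -> mdifferentiable f x.
Proof.
move=> [cf sf]; split; first exact: cf.
have [+ _] := sf _ _ (chart_at_atlas M x) (chart_at_atlas N (f x)) 1%N.
apply; split=> //; first exact: cod_fwd_at.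
by rewrite bwd_fwd_at; exact: chart_at_dom.
Qed.

Lemma differential_ext M N (f g : M -> N) x (v : model M) : f =1 g ->
  differential f x v = differential g x v :> model N.
Proof. by move=> /funext ->. Qed.

(** The middle charts cancel only near the point, where continuity of [f] keeps its values in the
    chart domain. A separate [y] allows base points that are only provably equal to [f x]; tangent
    vectors at both live in [model N]. *)
Lemma mdifferentiable_comp M N P (f : M -> N) (g : N -> P) x y : f x = y ->
  mdifferentiable f x -> mdifferentiable g y ->
  mdifferentiable (g \o f) x /\
  forall v : model M, differential (g \o f) x v =
    differential g y (differential f x v) :> model P.
Proof.
move=> <- [cf df] [cg dg].
have E : local_rep f x (fwd (chart_at M x) x) = fwd (chart_at N (f x)) (f x).
  by rewrite /local_rep /= bwd_fwd_at.
rewrite -E in dg.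
have H := differentiable_comp df dg.
have [d1 d2] : differentiable (local_rep (g \o f) x) (fwd (chart_at M x) x) /\
    'd (local_rep (g \o f) x) (fwd (chart_at M x) x) =
    'd (local_rep g (f x) \o local_rep f x) (fwd (chart_at M x) x)
    :> (model M -> model P).
  apply: near_diff_ext H; apply: filterS (near_dom_bwd cf) => u du.
  by rewrite /local_rep /= chartK.
split; first by split=> //; exact: continuous_comp.
move=> v; rewrite /differential d2 diff_comp//= E //.
Qed.

Lemma mdifferentiable_pair M N P (f : M -> N) (g : M -> P) x :
  mdifferentiable f x -> mdifferentiable g x ->
  mdifferentiable (fun z => (f z, g z) : prod_manifold N P) x /\
  forall v : model M, differential (fun z => (f z, g z) : prod_manifold N P) x v
    = (differential f x v, differential g x v) :> model (prod_manifold N P).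
Proof.
move=> [cf df] [cg dg].
have H := is_diff_pair (differentiableP df) (differentiableP dg).
split.
  split; first exact: cvg_pair.
  exact: (@ex_diff _ _ _ _ _ _ _ H).
move=> v; rewrite /differential.
by have -> := @diff_val _ _ _ _ _ _ _ H.
Qed.

(** Serves the two projections, whose representatives agree near the point with a linear [h], its
    own derivative. *)
Lemma mdifferentiable_of_rep M N (f : M -> N) x
    (h : model M -> model N) :
  {for x, continuous f} ->
  is_diff (fwd (chart_at M x) x) h h ->
  (\forall u \near fwd (chart_at M x) x, h u = local_rep f x u) ->
  mdifferentiable f x /\ forall v : model M, differential f x v = h v :> model N.
Proof.
move=> cf dh hf.
have [d1 d2] := near_diff_ext hf (@ex_diff _ _ _ _ _ _ _ dh).
split=> // v; rewrite /differential.
by have -> := d2; rewrite (@diff_val _ _ _ _ _ _ _ dh).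
Qed.

Lemma is_diff_fst (V W : normedModType R) (p : V * W) :
  is_diff p (fst : V * W -> V) fst.
Proof.
have c : continuous (fst : V * W -> V) by move=> x; exact: cvg_fst.
by apply: DiffDef; [exact: linear_differentiable|rewrite diff_lin].
Qed.

Lemma is_diff_snd (V W : normedModType R) (p : V * W) :
  is_diff p (snd : V * W -> W) snd.
Proof.
have c : continuous (snd : V * W -> W) by move=> x; exact: cvg_snd.
by apply: DiffDef; [exact: linear_differentiable|rewrite diff_lin].
Qed.

Lemma mdifferentiable_fst M N (x : prod_manifold M N) :
  mdifferentiable (fst : prod_manifold M N -> M) x /\
  forall v : model M * model N,
    differential (fst : prod_manifold M N -> M) x v = v.1 :> model M.
Proof.
apply: mdifferentiable_of_rep; first exact: cvg_fst.
  exact: is_diff_fst.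
have /= := @near_fwdK _ x; apply: filterS => u Eu.
by rewrite /local_rep /= -[in LHS]Eu.
Qed.

Lemma mdifferentiable_snd M N (x : prod_manifold M N) :
  mdifferentiable (snd : prod_manifold M N -> N) x /\
  forall v : model M * model N,
    differential (snd : prod_manifold M N -> N) x v = v.2 :> model N.
Proof.
apply: mdifferentiable_of_rep; first exact: cvg_snd.
  exact: is_diff_snd.
have /= := @near_fwdK _ x; apply: filterS => u Eu.
by rewrite /local_rep /= -[in LHS]Eu.
Qed.

Lemma mdifferentiable_cst M N (x : M) (y : N) :
  mdifferentiable (fun _ : M => y) x /\
  forall v : model M, differential (fun _ : M => y) x v = 0 :> model N.
Proof.
split.
  split; first exact: cvg_cst.
  exact: (differentiable_cst (fwd (chart_at N y) y)).
by move=> v; rewrite /differential (diff_cst (fwd (chart_at N y) y)).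
Qed.

Lemma eq_power_tangent M n (x : nat -> M) (v w : forall k, tangent (x k)) :
  (forall k, (k <= n)%N -> v k = w k) -> power_tangent n v = power_tangent n w.
Proof.
elim: n x v w => [|n IHn] x v w vw /=; first exact: vw.
congr pair; first exact: vw.
by apply: IHn => k kn; exact: vw.
Qed.

End differentials.

(** * Partial derivatives of [Upsilon] *)

Section upsilon.
Variables (R : realType) (G : lie_group R) (Q : manifold R) (l : action G Q).
Variable sB : smooth_structure R (orbit_space l).
Variable sT : smooth_structure R (orbit_space (twisted_action l)).
Let B := quotient_manifold sB.
Let T := quotient_manifold sT.
Variable A : discrete_connection l (orbit_proj l : Q -> B).

(** With [g = conn A (q0, q1)], the horizontal pair [(q0, g^-1 q1)] translated by [h] is
    [(h q0, (g h^-1)^-1 q1)], still horizontal by invariance. *)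
Lemma conn_actl h q0 q1 : conn A (l h q0, q1) = lmul (conn A (q0, q1)) (linv h).
Proof.
apply/esym/connP.
have /(connP A)[z _ Ez] : conn A (q0, q1) = conn A (q0, q1) by [].
have := hor_invariant h z.
rewrite Ez /= -actM linvM.
suff -> : linv (linv h) = h by [].
by rewrite -[LHS]rmul1 -(lmulV h) lmulA lmulV lmul1.
Qed.

(* For fixed [q1], twisting by [conn A (q, q1) * w^-1] moves [(q, w)] within
   its orbit onto the graph of [conn A (_, q1)]. *)
Definition graph_retraction (q1 : Q) (z : prod_manifold Q G) : Q :=
  l (lmul (conn A (z.1, q1)) (linv z.2)) z.1.

Lemma Upsilon1_graph_retraction q1 z :
  Upsilon1 sT A (graph_retraction q1 z, q1) = orbit_proj (twisted_action l) z.
Proof.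
apply/esym/orbit_projP; exists (lmul (conn A (z.1, q1)) (linv z.2)).
rewrite /= /twisted_act /graph_retraction conn_actl; congr pair.
by rewrite -[lmul (lmul _ _) z.2]lmulA lmulV rmul1.
Qed.

(** Ensures that the chain rule below yields [D1] at [q0] itself. *)
Lemma graph_retraction_conn q0 q1 : graph_retraction q1 (q0, conn A (q0, q1)) = q0.
Proof. by rewrite /graph_retraction rmulV act1. Qed.

Lemma twisted_proj_Upsilon1 x : twisted_proj l (Upsilon1 sT A x) = orbit_proj l x.1.
Proof. exact: twisted_projE. Qed.

Hypothesis pi_smooth : smooth_map (orbit_proj l : Q -> B).
Hypothesis l_smooth : smooth_action l.
Hypothesis piT : submersion (orbit_proj (twisted_action l) :
  prod_manifold Q G -> T).

Lemma mdifferentiable_Upsilon1 x : mdifferentiable (Upsilon1 sT A) x.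
Proof.
have [d1 _] := mdifferentiable_fst x.
have [d2 _] := mdifferentiable_pair d1
  (smooth_mdifferentiable x (conn_smooth A)).
exact: (mdifferentiable_comp erefl d2
  (smooth_mdifferentiable _ piT.1)).1.
Qed.

Lemma mdifferentiable_graph_retraction q1 z :
  mdifferentiable (graph_retraction q1) z.
Proof.
have [d1 _] := mdifferentiable_fst z.
have [d2 _] := mdifferentiable_snd z.
have [d3 _] := mdifferentiable_cst z q1.
have [d4 _] := mdifferentiable_pair d1 d3.
have [d5 _] := mdifferentiable_comp erefl d4
  (smooth_mdifferentiable _ (conn_smooth A)).
have [d6 _] := mdifferentiable_comp erefl d2
  (smooth_mdifferentiable _ (@linv_smooth _ G)).
have [d7 _] := mdifferentiable_pair d5 d6.
have [d8 _] := mdifferentiable_comp erefl d7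
  (smooth_mdifferentiable _ (@lmul_smooth _ G)).
have [d9 _] := mdifferentiable_pair d8 d1.
exact: (mdifferentiable_comp erefl d9 (smooth_mdifferentiable _ l_smooth)).1.
Qed.

(** Differentiating [Upsilon1_graph_retraction] at [z] writes the derivative of the orbit
    projection, which is onto, as [D1] of [Upsilon1] after that of the retraction. *)
Lemma D1_Upsilon1_surjective q0 q1 (w : model T) :
  exists dq : model Q, D1 (Upsilon1 sT A) (x := q0) q1 dq = w :> model T.
Proof.
pose z : prod_manifold Q G := (q0, conn A (q0, q1)).
have [v Ev] := piT.2 z w.
exists (differential (graph_retraction q1) z v).
have [d1 e1] := mdifferentiable_pair (mdifferentiable_graph_retraction q1 z)
  (mdifferentiable_cst z q1).1.
have E : (graph_retraction q1 z, q1) = (q0, q1) by rewrite graph_retraction_conn.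
have [_ e2] := mdifferentiable_comp
  (f := fun z => (graph_retraction q1 z, q1) : prod_manifold Q Q)
  E d1 (mdifferentiable_Upsilon1 (q0, q1)).
move: (e2 v); rewrite e1 (mdifferentiable_cst z q1).2.
rewrite /D1 => <-; rewrite -[RHS]Ev.
by apply: differential_ext => y /=; apply: Upsilon1_graph_retraction.
Qed.

Lemma differential_Upsilon1 q0 q1 (a b : model Q) :
  differential (Upsilon1 sT A) (q0, q1) (a, b) =
  D1 (Upsilon1 sT A) (x := q0) q1 a + D2 (Upsilon1 sT A) q0 (y := q1) b
  :> model T.
Proof.
have -> : (a, b) = (a, 0) + (0, b) :> model (prod_manifold Q Q).
  by congr pair; rewrite /= ?addr0 ?add0r.
exact: (raddfD (differential (Upsilon1 sT A) (q0, q1))).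
Qed.

Lemma differential_Upsilon q0 q1 (a b : model Q) :
  differential (Upsilon sT A) (q0, q1) (a, b) =
  (differential (Upsilon1 sT A) (q0, q1) (a, b),
   differential (orbit_proj l : Q -> B) q1 b) :> model T * model B.
Proof.
have [d1 e1] := mdifferentiable_snd ((q0, q1) : prod_manifold Q Q).
have [d2 e2] := mdifferentiable_comp (y := q1) erefl d1
  (smooth_mdifferentiable q1 pi_smooth).
have [_ e] := mdifferentiable_pair (mdifferentiable_Upsilon1 (q0, q1)) d2.
by move: (e (a, b)); rewrite e2 e1.
Qed.

Hypothesis phi_smooth : smooth_map (twisted_proj l : T -> B).

(** This is the chain rule applied to both sides of [twisted_proj_Upsilon1]. *)
Lemma differential_twisted_proj q0 q1 (a b : model Q) :
  differential (twisted_proj l : T -> B) (Upsilon1 sT A (q0, q1))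
    (differential (Upsilon1 sT A) (q0, q1) (a, b)) =
  differential (orbit_proj l : Q -> B) q0 a :> model B.
Proof.
have [_ e] := mdifferentiable_comp erefl (mdifferentiable_Upsilon1 (q0, q1))
  (smooth_mdifferentiable _ phi_smooth).
rewrite -e.
have [d1 e1] := mdifferentiable_fst ((q0, q1) : prod_manifold Q Q).
have [_ e2] := mdifferentiable_comp (y := q0) erefl d1
  (smooth_mdifferentiable q0 pi_smooth).
rewrite -[a in RHS]/((a, b).1) -e1 -e2.
by apply: differential_ext => x; exact: twisted_proj_Upsilon1.
Qed.

End upsilon.

(** * Comparison of the two classes of variations *)

Theorem corollary3p19 (R : realType) (Q : manifold R)
  (Ld : prod_manifold Q Q -> real_line R) (Ld_smooth : smooth_map Ld)
  (G : lie_group R) (l : action G Q)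
  (sB : smooth_structure R (orbit_space l))
  (Q_symmetry :
    symmetry_group l (orbit_proj l : Q -> quotient_manifold sB) Ld)
  (A : discrete_connection l (orbit_proj l : Q -> quotient_manifold sB))
  (sT : smooth_structure R (orbit_space (twisted_action l)))
  (sT_quotient : submersion (orbit_proj (twisted_action l) :
    prod_manifold Q G -> quotient_manifold sT))
  (S : dlp_system
    (twisted_proj l : quotient_manifold sT -> quotient_manifold sB))
  (S_associated : associated_dlp_system A Ld S)
  (N : nat) (N_ge2 : (2 <= N)%N) (q : nat -> Q) :
  trajectory S N (reduced_path sT A q) <->
  reduced_trajectory A (dlp_lagrangian S) N q.
Proof.
have [[[[pi_smooth _] _] l_smooth _ _] _] := Q_symmetry.
have [phi_smooth _ _] := dlp_bundle S.
have [_ assocP] := S_associated.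
(* From here [N] is [n.+2], so the last index [N.-1] computes to [n.+1]. *)
case: N N_ge2 => [//|[//|n]] _.
have dU := differential_Upsilon A pi_smooth sT_quotient.
have dU1 := differential_Upsilon1 sT A.
have dphi := differential_twisted_proj A pi_smooth sT_quotient phi_smooth.
split=> [[_ trajP] dq dq0 dqN|redP].
- apply: trajP; split=> /=.
  + by move=> k _; rewrite !dU /= dphi.
  + by rewrite dU /= dqN raddf0.
  exists (fun k => D1 (Upsilon1 sT A) (x := q k) (q k.+1) (dq k)); split.
  (* At the last index [dq N = 0] kills the [D2] term; at index 0, [dq 0 = 0] kills the [D1]
     term. *)
  + rewrite dU /= dU1 dqN /D2 -[RHS]addr0; congr (_ + _).
    exact: (raddf0 (differential (Upsilon1 sT A) _)).
  + by move=> k _ _; rewrite dU /= dU1 assocP.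
  + rewrite dU /= dU1 dq0 assocP -[RHS]add0r; congr (_ + _).
    exact: (raddf0 (differential (Upsilon1 sT A) _)).
- split; first by move=> k _; rewrite /second_order /= twisted_projE.
  move=> dc [dc2 dcN [w [wN wk w0]]].
  have /choice[dq' dq'E] : forall k, exists dq : model Q,
      D1 (Upsilon1 sT A) (x := q k) (q k.+1) dq = w k :> model _.
    by move=> k; exact: D1_Upsilon1_surjective.
  (* Truncation forces the fixed endpoints and keeps the lifts at the indices [1] to [n.+1], where
     the [w k] enter the variation. *)
  pose dq k : model Q := if (0 < k < n.+2)%N then dq' k else 0.
  have dqN : dq n.+2 = 0 by rewrite /dq ltnn andbF.
  (* Both sides apply the same differential, so it remains to match the tangent vectors. *)
  rewrite -(redP dq erefl dqN) /action_differential; congr (differential _ _ _).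
  have D1dq k : (0 < k)%N -> (k < n.+2)%N ->
      D1 (Upsilon1 sT A) (x := q k) (q k.+1) (dq k) = w k :> model _.
    by move=> k0 kn; rewrite /dq k0 kn; exact: dq'E.
  have D2dq k : (k < n.+1)%N -> D2 (Upsilon1 sT A) (q k) (y := q k.+1) (dq k.+1) =
      dlp_map S (reduced_path sT A q k) (reduced_path sT A q k.+1) (w k.+1)
      :> model _.
    move=> kn; rewrite -(assocP _ _ (q k.+2)).
    by congr (dlp_map S _ _ _); exact: D1dq.
  have E1 k : (k <= n.+1)%N -> (dc k).1 =
      differential (Upsilon1 sT A) (q k, q k.+1) (dq k, dq k.+1) :> model _.
    (* Three cases follow: the last index, where [D2] vanishes; the interior ones; and index 0,
       where [D1] vanishes. *)
    rewrite dU1 leq_eqVlt => /orP[/eqP ->|kn].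
      rewrite D1dq// dqN wN -[LHS]addr0; congr (_ + _); apply/esym.
      exact: (raddf0 (differential (Upsilon1 sT A) _)).
    rewrite D2dq//; case: k kn => [|k] kn; last by rewrite D1dq ?wk// ltnW.
    rewrite w0 -[LHS]add0r; congr (_ + _); apply/esym.
    exact: (raddf0 (differential (Upsilon1 sT A) _)).
  apply: eq_power_tangent => k kn; rewrite dU.
  rewrite [LHS]surjective_pairing E1//; congr pair.
  (* The base components both vanish at the last index; elsewhere each is the projected first
     component at [k.+1]. *)
  move: kn; rewrite leq_eqVlt => /orP[/eqP ->|kn].
    by rewrite dcN dqN raddf0.
  by rewrite dc2// E1// dphi.
Qed.
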